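(* Let $P$ be a pasture with at most one fundamental element. Then every matroid $M$ has at most one rescaling class of $P$-representations; i.e. any two $P$-representations of $M$ are rescaling equivalent.
   Context: A pasture is a commutative monoid $P$ with absorbing $0$ such that $P^\times=P\setminus\{0\}$ is a group, with a null set $N_P$ of formal sums $a+b+c$ satisfying: $a+0+0\in N_P$ iff $a=0$; closure under multiplying all terms by any $d\in P$; a unique $\epsilon$ with $1+\epsilon+0\in N_P$ (write $-a=\epsilon a$; ''$a+b=c$'' means $a+b+(-c)\in N_P$). A fundamental element of $P$ is $z\in P^\times$ with $z+z'=1$ for some $z'\in P^\times$. For a matroid $M$ of rank $r$ on finite $E$, a $P$-representation is $\Delta:E^r\to P$ with $\Delta(e_1,\dots,e_r)\neq0$ iff $\{e_1,\dots,e_r\}$ is a basis, $\Delta(e_{\sigma(1)},\dots,e_{\sigma(r)})=\mathrm{sign}(\sigma)\Delta(e_1,\dots,e_r)$, and $\Delta(\mathbf Je_1e_2)\Delta(\mathbf Je_3e_4)-\Delta(\mathbf Je_1e_3)\Delta(\mathbf Je_2e_4)+\Delta(\mathbf Je_1e_4)\Delta(\mathbf Je_2e_3)\in N_P$ for all $\mathbf J\in E^{r-2}$, $e_1,\dots,e_4\in E$ (concatenated tuples). $\Delta,\Delta'$ are rescaling equivalent if $\Delta'(e_1,\dots,e_r)=c\,d(e_1)\cdots d(e_r)\Delta(e_1,\dots,e_r)$ for some $c\in P^\times$, $d:E\to P^\times$. *)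

(* Defs.v *)
From mathcomp Require Import all_boot all_fingroup.
Set Implicit Arguments. Unset Strict Implicit. Unset Printing Implicit Defensive.

(* A pasture: commutative monoid P with absorbing 0, P \ {0} a group, and a
   null set N of (unordered) formal sums a+b+c, encoded as a ternary predicate
   invariant under permutations of its arguments. *)
Record pasture := Pasture {
  pcar :> Type;
  pmul : pcar -> pcar -> pcar;
  pone : pcar;
  pzero : pcar;
  pnull : pcar -> pcar -> pcar -> Prop;
  peps : pcar;
  pmulA : forall a b c, pmul a (pmul b c) = pmul (pmul a b) c;
  pmulC : forall a b, pmul a b = pmul b a;
  pmul1 : forall a, pmul pone a = a;
  pmul0 : forall a, pmul pzero a = pzero;
  pone_neq0 : pone <> pzero;
  pinv_ex : forall a, a <> pzero -> exists b, pmul a b = pone;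
  pnull_swap : forall a b c, pnull a b c -> pnull b a c;
  pnull_rot : forall a b c, pnull a b c -> pnull b c a;
  pnull00 : forall a, pnull a pzero pzero <-> a = pzero;
  pnull_mul : forall d a b c, pnull a b c -> pnull (pmul d a) (pmul d b) (pmul d c);
  peps_null : pnull pone peps pzero;
  peps_uniq : forall e, pnull pone e pzero -> e = peps
}.

Section Pas.
Variable P : pasture.
Local Notation "a * b" := (pmul a b).

Definition popp (a : P) : P := peps P * a.

Definition psum_eq (a b c : P) : Prop := pnull a b (popp c).

Definition fundamental (z : P) : Prop :=
  z <> pzero P /\ exists z' : P, z' <> pzero P /\ psum_eq z z' (pone P).

Definition at_most_one_fundamental : Prop :=
  forall z1 z2 : P, fundamental z1 -> fundamental z2 -> z1 = z2.

Definition psign (n : nat) (s : 'S_n) : P := if odd_perm s then peps P else pone P.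

Definition pprod (r : nat) (f : 'I_r -> P) : P :=
  foldr (fun i acc => f i * acc) (pone P) (enum 'I_r).
End Pas.

Definition is_matroid (E : finType) (bases : {set {set E}}) : Prop :=
  bases != set0 /\
  forall B1 B2, B1 \in bases -> B2 \in bases ->
    forall x, x \in B1 :\: B2 ->
      exists2 y, y \in B2 :\: B1 & (B1 :\ x) :|: [set y] \in bases.

Definition has_rank (E : finType) (bases : {set {set E}}) (r : nat) : Prop :=
  forall B, B \in bases -> #|B| = r.

Definition cat2 (E : finType) (r : nat) (J : (r - 2).-tuple E) (a b : E)
  : {ffun 'I_r -> E} :=
  [ffun i : 'I_r => nth a (tval J ++ [:: a; b]) i].

Definition is_representation (P : pasture) (E : finType) (bases : {set {set E}})
    (r : nat) (D : {ffun 'I_r -> E} -> P) : Prop :=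
  (forall x : {ffun 'I_r -> E},
      D x <> pzero P <-> [set x i | i : 'I_r] \in bases) /\
  (forall (x : {ffun 'I_r -> E}) (s : 'S_r),
      D [ffun i => x (s i)] = pmul (psign P s) (D x)) /\
  (1 < r -> forall (J : (r - 2).-tuple E) (e1 e2 e3 e4 : E),
      pnull (pmul (D (cat2 J e1 e2)) (D (cat2 J e3 e4)))
            (popp (pmul (D (cat2 J e1 e3)) (D (cat2 J e2 e4))))
            (pmul (D (cat2 J e1 e4)) (D (cat2 J e2 e3)))).

Definition rescaling_equiv (P : pasture) (E : finType) (r : nat)
    (D D' : {ffun 'I_r -> E} -> P) : Prop :=
  exists (c : P) (d : E -> P),
    c <> pzero P /\ (forall e, d e <> pzero P) /\
    forall x : {ffun 'I_r -> E},
      D' x = pmul c (pmul (pprod (fun i => d (x i))) (D x)).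

(* Main.v *)
Require Import Defs.
From HB Require Import structures.
From mathcomp Require Import all_boot all_fingroup ssralg zify boolp.
Set Implicit Arguments.
Unset Strict Implicit.
Unset Printing Implicit Defensive.
Import GRing.Theory.

(* Fix representations D, D'. If a - b + c = 0 has all terms nonzero then a / b
   is a fundamental element; hence ratios of products in the 3-term Pluecker
   relations are the same for D and D', and u = D' / D, as a function of bases,
   satisfies u(Sab) u(Scd) = u(Sac) u(Sbd) whenever these four sets are bases.

   For a basis B, put the weight (u(B - x + y) / u(B))^(+-1) on the edges of the
   bipartite graph on E in which x in B is adjacent to y outside B when
   B - x + y is a basis. Every closed walk x0 x1 ... xm = x0 has trivial weight,
   for all B at once, by induction on m: an edge x0 x3, or one from x1 or x2 to
   a later vertex, cuts the walk into shorter ones, and 4-cycles are the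
   relations above; without such edges, exchanging x1 and x2 yields a basis for
   which x0 x3 is an edge of weight that of x0 x1 x2 x3, all later edges
   being unchanged.

   So at one basis the weights are differences of a potential d, that is,
   u = c prod d at that basis and its neighbours, and the relations propagate
   this formula along the basis exchange graph. *)

(** * Exchanging one element of a set for another *)

Definition swap (E : finType) (B : {set E}) (x y : E) : {set E} :=
  [set w | (w \in B) (+) (w == x) (+) (w == y)].

Section Swap.
Variable E : finType.
Implicit Types (B S : {set E}) (x y z t : E).

(** Because [swap] toggles membership by exclusive or, this identity and the composition laws below
    hold with no hypothesis on which elements lie in [B]. *)
Lemma swapC B x y : swap B x y = swap B y x.
Proof. by apply/setP=> w; rewrite !inE addbAC. Qed.

Lemma swapK B x y : swap (swap B x y) y x = B.
Proof.
by apply/setP=> w; rewrite !inE; do !case: (_ == _); case: (_ \in _).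
Qed.

Lemma swapxx B x : swap B x x = B.
Proof. by apply/setP=> w; rewrite !inE addbK. Qed.

Lemma swap_trans B x y t : swap (swap B x y) y t = swap B x t.
Proof.
by apply/setP=> w; rewrite !inE; do !case: (_ == _); case: (_ \in _).
Qed.

Lemma swap_swap_mid B x0 x1 x2 x3 :
  swap (swap B x0 x1) x2 x3 = swap (swap B x1 x2) x0 x3.
Proof.
by apply/setP=> w; rewrite !inE; do !case: (_ == _); case: (_ \in _).
Qed.

Lemma in_swap B x y w :
  w != x -> w != y -> (w \in swap B x y) = (w \in B).
Proof. by move=> /negPf wx /negPf wy; rewrite inE wx wy !addbF. Qed.

Lemma swapE B x y : x \in B -> y \notin B -> swap B x y = (B :\ x) :|: [set y].
Proof.
move=> xB yB; apply/setP=> w; rewrite !inE.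
case: (eqVneq w y) => [->|_].
  by rewrite (negPf yB) orbT; case: eqP => // yx; rewrite -yx (negPf yB) in xB.
by rewrite addbF orbF; case: eqP => [->|_]; rewrite ?xB ?addbF.
Qed.

Variables (B : {set E}) (x y z t : E).
Hypotheses (xB : x \in B) (zB : z \in B) (yB : y \notin B) (tB : t \notin B).
Hypotheses (xz : x != z) (yt : y != t).
Let S := B :\ x :\ z.

Lemma swap_neq : [/\ x != y, x != t, z != y & z != t].
Proof.
by split; [move: yB|move: tB|move: yB|move: tB]; apply: contraNneq => <-.
Qed.

(** This lemma and the next three form a dictionary: over S = B - x - z, the six sets in the
    three-term relation on x, y, z, t are [B], four single exchanges of [B] and one double
    exchange. *)
Lemma setU2_self : S :|: [set x; z] = B.
Proof.
apply/setP=> w; rewrite !inE.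
case: (eqVneq w x) => [->|_]; first by rewrite /= orbT xB.
by case: (eqVneq w z) => [->|_]; rewrite /= ?orbT ?zB ?orbF.
Qed.

Lemma setU2_swap2 : S :|: [set y; t] = swap (swap B x y) z t.
Proof.
have [/negPf xy /negPf xt /negPf zy /negPf zt] := swap_neq.
apply/setP=> w; rewrite !inE.
case: (eqVneq w x) => [->|_]; first by rewrite xB (negPf xz) xy xt.
case: (eqVneq w z) => [->|_]; first by rewrite zB zy zt.
case: (eqVneq w y) => [->|_]; first by rewrite (negPf yB) (negPf yt).
case: (eqVneq w t) => [->|_]; first by rewrite (negPf tB).
by rewrite /= !addbF orbF.
Qed.

End Swap.

Lemma setU2_swap (E : finType) (B : {set E}) (x y z : E) :
  x \in B -> z \in B -> y \notin B -> x != z ->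
  B :\ x :\ z :|: [set x; y] = swap B z y.
Proof.
move=> xB zB yB xz; rewrite swapE //; apply/setP=> w; rewrite !inE.
by case: (eqVneq w x) => [->|_] //=; rewrite xB xz.
Qed.

Lemma setU2_swapr (E : finType) (B : {set E}) (x y z : E) :
  x \in B -> z \in B -> y \notin B -> x != z ->
  B :\ x :\ z :|: [set z; y] = swap B x y.
Proof.
by move=> xB zB yB xz; rewrite setDDl (setUC [set x]) -setDDl setU2_swap // eq_sym.
Qed.

(** * Weights on the exchange graph of a basis *)

Section ExchangeWeights.
Local Open Scope ring_scope.
Variables (E : finType) (G : zmodType).
Variables (bases : {set {set E}}) (u : {set E} -> G).
Implicit Types (B S : {set E}) (x y z t : E).

(** All that is kept of the three-term relations: a nonzero product never stands alone, and two
    nonzero products have the same ratio for both representations. The group of units is written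
    additively. *)
Hypothesis pair_exchange : forall S a b c d,
  a != b -> a \notin S -> b \notin S ->
  S :|: [set a; b] \in bases -> S :|: [set c; d] \in bases ->
  (S :|: [set a; c] \in bases) && (S :|: [set b; d] \in bases) ||
  (S :|: [set a; d] \in bases) && (S :|: [set b; c] \in bases).

Hypothesis pair_weight : forall S a b c d,
  a != b -> a \notin S -> b \notin S ->
  S :|: [set a; b] \in bases -> S :|: [set c; d] \in bases ->
  S :|: [set a; c] \in bases -> S :|: [set b; d] \in bases ->
  u (S :|: [set a; b]) + u (S :|: [set c; d]) =
  u (S :|: [set a; c]) + u (S :|: [set b; d]).

Definition adj B x y := ((x \in B) != (y \in B)) && (swap B x y \in bases).

(** The sign is chosen so that, for u = c + sum of d, an edge x y has weight d y - d x whichever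
    endpoint lies in [B]. *)
Definition step_weight B x y : G :=
  if x \in B then u (swap B x y) - u B else u B - u (swap B x y).

Fixpoint holonomy B x (p : seq E) : G :=
  if p is y :: p' then step_weight B x y + holonomy B y p' else 0.

Lemma adjC B x y : adj B x y = adj B y x.
Proof. by rewrite /adj eq_sym swapC. Qed.

Lemma adj_irr B x : adj B x x = false.
Proof. by rewrite /adj eqxx. Qed.

Lemma step_weightC B x y :
  (x \in B) != (y \in B) -> step_weight B y x = - step_weight B x y.
Proof.
by rewrite /step_weight swapC; case: (x \in B); case: (y \in B); rewrite ?opprB.
Qed.

(** This is the relation over B - x - z on x, y, z, t. The four exchanges are the factors of two of
    its products, while [B] and the double exchange form the third. *)
Lemma swap_square B x y z t :
  adj B x y -> adj B z t -> adj B x t -> adj B z y ->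
  u (swap B x y) + u (swap B z t) = u (swap B x t) + u (swap B z y).
Proof.
wlog xB : x y z t / x \in B.
  move=> W xy zt xt zy; case: (boolP (x \in B)) => xB; first exact: W.
  have yB : y \in B by move: xy; rewrite /adj (negPf xB); case: (y \in B).
  rewrite (swapC B x y) (swapC B z t) (swapC B x t) (swapC B z y) [RHS]addrC.
  by apply: W => //; rewrite adjC.
rewrite /adj xB.
case: (boolP (y \in B)) => yB //=; case: (boolP (z \in B)) => //= zB.
case: (boolP (t \in B)) => tB //= xy zt xt zy.
have [<-|xz] := eqVneq x z; first by rewrite addrC.
set S := B :\ x :\ z.
have Exy : S :|: [set z; y] = swap B x y by rewrite setU2_swapr.
have Ezt : S :|: [set t; x] = swap B z t by rewrite (setUC [set t]) setU2_swap.
have Ext : S :|: [set z; t] = swap B x t by rewrite setU2_swapr.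
have Ezy : S :|: [set y; x] = swap B z y by rewrite (setUC [set y]) setU2_swap.
have [zNy _ _ _] := swap_neq zB xB yB tB.
rewrite -Exy -Ezt -Ext -Ezy.
apply: pair_weight; rewrite ?Exy ?Ezt ?Ext ?Ezy //.
  by rewrite !inE eqxx.
by rewrite !inE (negPf yB) !andbF.
Qed.

(* Unless x, y, z, t span a 4-cycle, one of the three products in the
   Pluecker relation vanishes, so the other two survive together. *)
Lemma swap_pair B x y z t : B \in bases ->
  adj B x y -> adj B z t -> (x \in B) = (z \in B) ->
  ~~ (adj B x t && adj B z y) ->
  swap (swap B x y) z t \in bases /\
  u B + u (swap (swap B x y) z t) = u (swap B x y) + u (swap B z t).
Proof.
move=> BB.
wlog xB : x y z t / x \in B.
  move=> W xy zt xzB Nxt; case: (boolP (x \in B)) => xB; first exact: W.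
  have yB : y \in B by move: xy; rewrite /adj (negPf xB); case: (y \in B).
  have tB : t \in B.
    by move: zt; rewrite /adj -xzB (negPf xB); case: (t \in B).
  rewrite (swapC B x) (swapC B z) (swapC _ z).
  apply: W; rewrite ?yB ?tB //; last by rewrite andbC (adjC _ t) (adjC _ y).
    by rewrite adjC.
  by rewrite adjC.
rewrite xB => + + /esym zB; rewrite /adj xB zB.
case: (boolP (y \in B)) => yB //=; case: (boolP (t \in B)) => //= tB xy zt Nxt.
have [E1|xz] := eqVneq x z; first by move: Nxt; rewrite E1 zt -E1 xy.
have [E1|yt] := eqVneq y t; first by move: Nxt; rewrite -E1 xy E1 zt.
set S := B :\ x :\ z.
have Exy : S :|: [set z; y] = swap B x y by rewrite setU2_swapr.
have Ezt : S :|: [set x; t] = swap B z t by rewrite setU2_swap.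
have Ext : S :|: [set z; t] = swap B x t by rewrite setU2_swapr.
have Eyx : S :|: [set y; x] = swap B z y by rewrite (setUC [set y]) setU2_swap.
have EB : S :|: [set z; x] = B by rewrite (setUC [set z]) setU2_self.
have E2 : S :|: [set y; t] = swap (swap B x y) z t by rewrite setU2_swap2.
have [zy _ _ xt] := swap_neq zB xB yB tB.
have zS : z \notin S by rewrite !inE eqxx.
have yS : y \notin S by rewrite !inE (negPf yB) !andbF.
have := @pair_exchange S z y x t zy zS yS; rewrite Exy Ezt EB E2 Ext Eyx.
rewrite xy zt (negPf Nxt) orbF => /(_ isT isT)/andP[_ B2]; split=> //.
rewrite -E2 -Exy -Ezt -{1}EB; apply/esym.
by apply: pair_weight; rewrite // ?Exy ?Ezt ?EB ?E2.
Qed.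

Lemma adj_neq B x y : adj B x y -> x != y.
Proof. by apply: contraTneq => ->; rewrite adj_irr. Qed.

(** One of [x1], [x2] lies on the side of [B] opposite to [y]. Since it is not adjacent to [y], the
    edges x1 x2 and y z do not span a 4-cycle, so their double exchange is a basis and [u] is
    additive on it. *)
Lemma pivot_keep B x1 x2 y z : B \in bases -> adj B x1 x2 ->
  adj B y z -> ~~ adj B x1 y -> ~~ adj B x2 y ->
  adj (swap B x1 x2) y z /\
  step_weight (swap B x1 x2) y z = step_weight B y z.
Proof.
move=> BB.
wlog x1y : x1 x2 / (x1 \in B) = (y \in B).
  move=> W a12 yz n1 n2.
  have [E1|x1y] := eqVneq (x1 \in B) (y \in B); first exact: W.
  rewrite swapC; apply: W; rewrite // 1?adjC //.
  by case/andP: a12 x1y; do 3!case: (_ \in _).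
move=> a12 yz n1 n2.
have [yx1 yx2 zx1 zx2] : [/\ y != x1, y != x2, z != x1 & z != x2].
  split; apply/eqP.
  - by move=> E1; rewrite adjC E1 a12 in n2.
  - by move=> E1; rewrite E1 a12 in n1.
  - by move=> E1; rewrite adjC -E1 yz in n1.
  - by move=> E1; rewrite adjC -E1 yz in n2.
have [|B2 uE] := swap_pair BB a12 yz x1y; first 
  by rewrite (adjC _ y) (negPf n2) andbF.
rewrite /adj /step_weight !in_swap // B2 andbT; case/andP: yz => -> _; split=> //.
have E1 : u (swap (swap B x1 x2) y z) - u (swap B x1 x2) = u (swap B y z) - u B.
  by apply/eqP; rewrite subr_eq addrAC eq_sym subr_eq addrC [eqbRHS]addrC uE.
by rewrite E1 -[u _ - u (swap _ y z)]opprB E1 opprB.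
Qed.

(** The missing edge x0 x3 makes the double exchange along x0 x1 and x2 x3 a basis; by
    [swap_swap_mid] it is also the exchange of [x0], [x3] after pivoting on x1 x2. *)
Lemma pivot_shortcut B x0 x1 x2 x3 : B \in bases ->
  adj B x1 x2 -> adj B x0 x1 -> adj B x2 x3 -> ~~ adj B x0 x3 ->
  adj (swap B x1 x2) x0 x3 /\
  step_weight (swap B x1 x2) x0 x3 =
  step_weight B x0 x1 + (step_weight B x1 x2 + step_weight B x2 x3).
Proof.
move=> BB a12 a01 a23 n03.
have x02 : (x0 \in B) = (x2 \in B).
  by case/andP: a01; case/andP: a12; do 3!case: (_ \in _).
have x13 : (x1 \in B) = (x3 \in B).
  by case/andP: a23; case/andP: a12; do 3!case: (_ \in _).
have [n01 n02] : x0 != x1 /\ x0 != x2.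
  by split; [exact: adj_neq a01 | apply: contraNneq n03 => ->].
have [n31 n32] : x3 != x1 /\ x3 != x2.
  by split; [apply: contraNneq n03 => -> | rewrite eq_sym; exact: adj_neq a23].
have [|] := swap_pair BB a01 a23 x02; first by rewrite (negPf n03).
rewrite swap_swap_mid => B2 uE.
rewrite /adj /step_weight !in_swap // B2 andbT -x13 -x02.
case/andP: a01; case/andP: a12; case: (x0 \in B) x02 => <-.
  case: (x1 \in B) => //= _ _ _ _; split=> //.
  by rewrite addrA subrKA addrACA -uE addrACA addrC subrKA.
case: (x1 \in B) => //= _ _ _ _; split=> //.
by rewrite subrKA addrACA -opprD -uE opprD addrACA subrr add0r.
Qed.

(** * Closed walks and potentials *)

Lemma holonomy_cat B x p q :
  holonomy B x (p ++ q) = holonomy B x p + holonomy B (last x p) q.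
Proof. by elim: p x => [|y p IHp] x /=; rewrite ?add0r // IHp addrA. Qed.

(** Only the starting point of each edge is tested, so the last vertex may be adjacent to [x1] or
    [x2]. This matters for a closed walk, which returns to a neighbour of [x1]. *)
Lemma pivot_keep_path B x1 x2 y p : B \in bases -> adj B x1 x2 ->
  path (adj B) y p ->
  all (fun z => ~~ adj B x1 z && ~~ adj B x2 z) (belast y p) ->
  path (adj (swap B x1 x2)) y p /\
  holonomy (swap B x1 x2) y p = holonomy B y p.
Proof.
move=> BB a12; elim: p y => //= z p IHp y /andP[yz pz] /andP[/andP[n1 n2] ap].
have [-> ->] := pivot_keep BB a12 yz n1 n2.
by have [-> ->] := IHp z pz ap.
Qed.

Lemma closed_walk_holonomy B x p : B \in bases ->
  path (adj B) x p -> last x p = x -> holonomy B x p = 0.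
Proof.
have [n] := ubnP (size p); elim: n => // n IHn in B x p *.
rewrite ltnS => len BB.
(* There are no loops, a walk of length 2 retraces its edge, and length 3 is impossible in a
   bipartite graph. *)
case: p len => [|x1 [|x2 [|x3 [|x4 q]]]] //=.
- by move=> _ /andP[+ _] E1; rewrite E1 adj_irr.
- move=> _ /andP[a01 _] ->; rewrite addr0 (@step_weightC _ x x1) ?subrr //.
  by case/andP: a01.
- move=> _ /and3P[a01 a12 a23] E1; move: a23; rewrite E1.
  by move: a01 a12; rewrite /adj; do 3!case: (_ \in _).
move=> len /and5P[a01 a12 a23 a34 pq] lastq.
have W a b : adj B a b -> step_weight B b a = - step_weight B a b.
  by case/andP=> ab _; exact: step_weightC.
case: q => [|x5 q] in len pq lastq *.
  move: lastq a34 => /= ->; rewrite adjC => a03.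
  have x02 : (x \in B) = (x2 \in B).
    by case/andP: a01; case/andP: a12; do 3!case: (_ \in _).
  have := swap_square a01 a23 a03; rewrite (adjC B x2) a12 => /(_ isT) uE.
  rewrite addr0 (W _ _ a03) /step_weight (swapC B x1 x2).
  have -> : (x1 \in B) = ~~ (x \in B).
    by case/andP: a01; do 2!case: (_ \in _).
  rewrite -x02; case: (x \in B) => /=; rewrite opprB.
    rewrite subrKA addrA subrKA addrACA uE -opprD.
    by rewrite [_ + u (swap _ _ x3)]addrC subrr.
  rewrite [X in _ + (_ + X)]addrC subrKA addrA [X in X + _]addrC subrKA addrACA.
  by rewrite -opprD uE addrC [u _ + u (swap _ _ x3)]addrC addNr.
(* The chord x x3 splits the walk into a 4-cycle and a closed walk shorter by two. *)
have [a03|n03] := boolP (adj B x x3).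
  have := IHn B x [:: x1; x2; x3; x].
  rewrite /= a01 a12 a23 (adjC _ x3) a03 addr0.
  move=> H1; have H2 : holonomy B x [:: x3, x4, x5 & q] = 0.
    by apply: IHn => //; [move: len => /=; lia | apply/and3P].
  move: H2; rewrite [holonomy _ _ _]/= addrC => /eqP.
  by rewrite addr_eq0 -W // => /eqP ->; apply: H1 => //; apply: leq_trans len.
(* Without chords from [x1] or [x2] to [x4] or beyond, the final [x] excepted, pivoting on x1 x2
   turns the walk into x x3 x4 ..., shorter by two, at another basis. *)
have [nc|] := boolP (all (fun z => ~~ adj B x1 z && ~~ adj B x2 z)
                         (belast x4 (x5 :: q))).
  have [c1 c2] : ~~ adj B x1 x4 /\ ~~ adj B x2 x4 by case/andP: nc => /andP[].
  have B1B : swap B x1 x2 \in bases by case/andP: a12.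
  have [a03 W03] := pivot_shortcut BB a12 a01 a23 n03.
  have [pq1 hq] := pivot_keep_path BB a12 pq nc.
  (* The edge x3 x4 is traversed backwards, because [x3] is a neighbour of [x2] and cannot be the
     tested endpoint. *)
  have [a43 W43] := pivot_keep BB a12 (etrans (adjC B x4 x3) a34) c1 c2.
  have := IHn (swap B x1 x2) x [:: x3, x4 & x5 :: q] _ B1B.
  move: (x5 :: q) len pq lastq pq1 hq {nc} => r len pq lastq pq1 hq /=.
  rewrite a03 (adjC _ x3) a43 pq1 hq W03 => IH.
  rewrite -IH //; last by apply: leq_trans len.
  rewrite -!addrA (@step_weightC (swap B x1 x2) x4 x3); last by case/andP: a43.
  by rewrite W43 (W _ _ a34) opprK.
move=> /allPn[y]; rewrite negb_and !negbK => yt.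
have : path (adj B) x3 (x4 :: x5 :: q) by apply/andP.
rewrite -[step_weight B x3 x4 + _]/(holonomy B x3 (x4 :: x5 :: q)).
have lt : size (x4 :: x5 :: q) + 3 <= n by rewrite addn3.
(* The chord ends at a vertex [y] strictly before the final [x], so both closed walks that it cuts
   off are shorter. *)
rewrite lastI [last _ _]lastq in lt *; case/splitPr: yt lt => p1 p2.
rewrite rcons_cat rcons_cons size_cat /= size_rcons => lt.
rewrite cat_path /= => /and3P[pp1 ay pp2].
rewrite holonomy_cat /=.
case/orP=> [a1y|a2y].
  have H1 : holonomy B x1 ([:: x2, x3 & p1] ++ [:: y; x1]) = 0.
    apply: IHn => //; last by rewrite last_cat.
      by rewrite size_cat /=; lia.
    by rewrite cat_path /= a12 a23 pp1 ay adjC a1y.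
  have H2 : holonomy B x [:: x1, y & rcons p2 x] = 0.
    apply: IHn => //=; rewrite ?last_rcons ?size_rcons ?a01 ?a1y //; lia.
  move: H1 H2; rewrite holonomy_cat /= (W _ _ a1y) addr0 => H1 H2.
  rewrite -H2; congr (_ + _); rewrite !addrA in H1 *.
  by rewrite (subr0_eq H1).
have H1 : holonomy B x2 ([:: x3 & p1] ++ [:: y; x2]) = 0.
  apply: IHn => //; last by rewrite last_cat.
    by rewrite size_cat /=; lia.
  by rewrite cat_path /= a23 pp1 ay adjC a2y.
have H2 : holonomy B x [:: x1, x2, y & rcons p2 x] = 0.
  apply: IHn => //=; rewrite ?last_rcons ?size_rcons ?a01 ?a12 ?a2y //; lia.
move: H1 H2; rewrite holonomy_cat /= (W _ _ a2y) addr0 => H1 H2.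
rewrite -H2; do 2!congr (_ + _); rewrite !addrA in H1 *.
by rewrite (subr0_eq H1).
Qed.
(** Integrate the weights from the root of each connected component along a chosen walk; vanishing
    holonomy makes the choice irrelevant. *)
Lemma step_weight_potential B : B \in bases ->
  exists d : E -> G, forall x y, adj B x y -> d y = d x + step_weight B x y.
Proof.
move=> BB.
have symA : connect_sym (adj B) by apply: sym_connect_sym => x y; exact: adjC.
pose potential_at x (v : G) := exists p, [/\ path (adj B) (root (adj B) x) p,
  last (root (adj B) x) p = x & v = holonomy B (root (adj B) x) p].
have /fin_all_exists [d dP] x : exists v, potential_at x v.
  have : connect (adj B) (root (adj B) x) x by rewrite symA connect_root.
  by case/connectP=> p pp xE; exists (holonomy B (root (adj B) x) p), p.
exists d => x y xy; case: (dP x) (dP y) => [p [pp lp ->]] [q [pq lq ->]].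
have rE : root (adj B) x = root (adj B) y by apply/rootP; rewrite // connect1.
move: pq lq; rewrite -rE => pq lq.
(* The same return walk [s] closes both the walk to [y] and the walk to [x] prolonged by x y, so its
   holonomy cancels. *)
have /connectP[s ps ls] : connect (adj B) y (root (adj B) x).
  by rewrite rE connect_root.
have Hq : holonomy B (root (adj B) x) (q ++ s) = 0.
  by apply: closed_walk_holonomy; rewrite ?cat_path ?last_cat ?lq ?pq.
have Hp : holonomy B (root (adj B) x) (p ++ y :: s) = 0.
  by apply: closed_walk_holonomy; rewrite ?cat_path ?last_cat ?lp /= ?pp ?xy.
move: Hp Hq; rewrite !holonomy_cat lp lq /= addrA => <- /addIr ->.
by [].
Qed.

(** * Propagating the affine formula from basis to basis *)

Lemma sum_swap (d : E -> G) B x y : x \in B -> y \notin B ->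
  \sum_(e in swap B x y) d e = \sum_(e in B) d e - d x + d y.
Proof.
move=> xB yB; rewrite (big_setD1 x xB) /= [d x + _]addrC addrK swapE //.
by rewrite setUC big_setU1 ?inE ?negb_and ?yB ?orbT //= addrC.
Qed.

Definition locally_affine (g : {set E} -> G) B :=
  u B = g B /\ forall x y, x \in B -> y \notin B ->
    swap B x y \in bases -> u (swap B x y) = g (swap B x y).

(** A neighbour of the new basis is [B], a neighbour of [B], or a double exchange of [B]. In the
    last case a surviving product of the three-term relation involves only neighbours of [B], where
    u = g, and [g] satisfies the same relation. *)
Lemma locally_affine_swap (c : G) (d : E -> G) B x y :
  let g S := c + \sum_(e in S) d e in
  B \in bases -> x \in B -> y \notin B -> swap B x y \in bases ->
  locally_affine g B -> locally_affine g (swap B x y).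
Proof.
move=> g BB xB yB xyB [uB uN]; split; first exact: uN.
have xNy : x != y by apply: contraNneq yB => <-.
have yB1 : y \in swap B x y by rewrite inE (negPf yB) eqxx eq_sym (negPf xNy).
have xB1 : x \notin swap B x y by rewrite inE xB eqxx (negPf xNy).
have gS S z t : z \in S -> t \notin S -> g (swap S z t) = g S - d z + d t.
  by move=> zS tS; rewrite /g sum_swap // !addrA.
clearbody g; move=> z t; have [->|zy] := eqVneq z y.
  move=> _; rewrite swap_trans; have [->|tx] := eqVneq t x.
    by rewrite swapxx.
  have [->|ty] := eqVneq t y; first by rewrite yB1.
  by rewrite in_swap //; exact: uN.
have [->|zx] := eqVneq z x; first by rewrite (negPf xB1).
rewrite in_swap // => zB; have [->|tx] := eqVneq t x.
  by move=> _; rewrite (swapC _ z) (swapC B x) swap_trans (swapC B y); exact: uN.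
have [->|ty] := eqVneq t y; first by rewrite yB1.
rewrite in_swap // => tB B2.
have xz : x != z by rewrite eq_sym.
have yt : y != t by rewrite eq_sym.
(* For [g] all three products agree, whichever of the sets are bases; this serves both alternatives
   of [pair_exchange]. *)
have g2 : g B + g (swap (swap B x y) z t) = g (swap B x y) + g (swap B z t).
  rewrite (gS (swap B x y)) ?in_swap // (gS B z t) //.
  by rewrite -!addrA; apply: addrCA.
have g2' : g (swap B x y) + g (swap B z t) = g (swap B z y) + g (swap B x t).
  by rewrite !gS // addrACA [RHS]addrACA; congr (_ + _); exact: addrC.
set S := B :\ x :\ z.
have EB : S :|: [set x; z] = B by rewrite setU2_self.
have E2 : S :|: [set y; t] = swap (swap B x y) z t by rewrite setU2_swap2.
have Exy : S :|: [set x; y] = swap B z y by rewrite setU2_swap.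
have Ezt : S :|: [set z; t] = swap B x t by rewrite setU2_swapr.
have Ext : S :|: [set x; t] = swap B z t by rewrite setU2_swap.
have Ezy : S :|: [set z; y] = swap B x y by rewrite setU2_swapr.
have xS : x \notin S by rewrite !inE eqxx andbF.
have zS : z \notin S by rewrite !inE eqxx.
have := @pair_exchange S x z y t xz xS zS; rewrite EB E2 Exy Ezt Ext Ezy.
move=> /(_ BB B2)/orP[/andP[b1 b2]|/andP[b1 b2]]; apply: (@addrI _ (u B)).
  rewrite [in RHS]uB g2 g2' -!uN // -Exy -Ezt -E2 -{1}EB.
  by apply: pair_weight; rewrite // ?EB ?E2 ?Exy ?Ezt.
rewrite [in RHS]uB g2 addrC -!uN // -E2 -Ext -Ezy (setUC [set y]) -{1}EB.
by rewrite addrC [RHS]addrC; apply: pair_weight; 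
  rewrite // ?(setUC [set t]) ?EB ?E2 ?Ext ?Ezy.
Qed.

Hypothesis matroid : is_matroid bases.

Theorem exchange_weight_affine :
  exists (c : G) (d : E -> G),
    forall B, B \in bases -> u B = c + \sum_(e in B) d e.
Proof.
case: matroid => /set0Pn[B0 B0B] exch.
have [d dP] := step_weight_potential B0B.
pose g S := u B0 - \sum_(e in B0) d e + \sum_(e in S) d e.
exists (u B0 - \sum_(e in B0) d e), d => B BB; rewrite -/(g B).
suff: locally_affine g B by case.
have [n] := ubnP #|B :\: B0|; elim: n => // n IHn in B BB *.
rewrite ltnS => len; case: (set_0Vmem (B :\: B0)) => [BB0|[x xBB0]].
  have -> : B = B0.
    (* Equal cardinality of bases is not assumed here: an element of B0 outside [B] would have to be
       exchanged for one of B outside [B0], and there is none. *)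
    apply/eqP; rewrite eqEsubset -setD_eq0 BB0 eqxx /= -setD_eq0.
    apply/set0Pn=> -[x xB]; have [y] := exch _ _ B0B BB x xB.
    by rewrite BB0 inE.
  split=> [|x y xB yB xyB]; first by rewrite /g subrK.
  rewrite /g sum_swap // (dP x y); last by rewrite /adj xB (negPf yB).
  rewrite /step_weight xB [_ - d x + _]addrA subrK addrA subrK.
  by rewrite addrC subrK.
have [y yB0B Exy] := exch _ _ BB B0B x xBB0.
move: xBB0 yB0B len; rewrite !inE => /andP[xB0 xB] /andP[yB yB0] len.
rewrite -swapE // in Exy.
have xy : x != y by apply: contraNneq yB => <-.
(* [B] is reached by the inverse exchange from B - x + y, which has fewer elements outside [B0]. *)
rewrite -(swapK B x y); apply: locally_affine_swap => //.
- by rewrite inE (negPf yB) eqxx eq_sym (negPf xy).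
- by rewrite inE xB eqxx (negPf xy).
- by rewrite swapK.
apply: IHn => //; apply: leq_trans len; apply: proper_card.
apply/properP; split; last by exists x; rewrite !inE ?xB ?xB0 // eqxx (negPf xy).
apply/subsetP=> w; rewrite swapE // !inE => /andP[wB0 /orP[/andP[_ ->]|/eqP wy]].
  by rewrite wB0.
by rewrite wy yB0 in wB0.
Qed.

End ExchangeWeights.

(** * Arithmetic in a pasture and its group of units *)

Section PastureArithmetic.
Variable P : pasture.
Local Notation "a * b" := (pmul a b).
Local Notation "0" := (pzero P).
Local Notation "1" := (pone P).
Implicit Types a b c z : P.

Lemma pmul0r a : a * 0 = 0.
Proof. by rewrite pmulC pmul0. Qed.

Lemma pmul1r a : a * 1 = a.
Proof. by rewrite pmulC pmul1. Qed.

Lemma pmulI a b c : a <> 0 -> a * b = a * c -> b = c.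
Proof.
move=> /pinv_ex[a' aa'] /(congr1 (pmul a')).
by rewrite !pmulA (pmulC a') aa' !pmul1.
Qed.

Lemma pmul_neq0 a b : a <> 0 -> b <> 0 -> a * b <> 0.
Proof. by move=> a0 b0 ab0; apply: b0; apply: (pmulI a0); rewrite pmul0r. Qed.

Lemma pinv_neq0 a b : a * b = 1 -> b <> 0.
Proof. by move=> ab b0; apply: (@pone_neq0 P); rewrite -ab b0 pmul0r. Qed.

Lemma peps_neq0 : peps P <> 0.
Proof.
by move=> e0; have := peps_null P; rewrite e0 pnull00; exact: pone_neq0.
Qed.

Lemma popp0 : popp 0 = 0 :> P.
Proof. exact: pmul0r. Qed.

Lemma poppM a b : popp (a * b) = a * popp b.
Proof. by rewrite /popp !pmulA (pmulC a). Qed.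

Lemma popp_inj a b : popp a = popp b -> a = b.
Proof. exact: pmulI peps_neq0. Qed.

Lemma pnull_two a b : a <> 0 -> pnull a b 0 -> b = popp a.
Proof.
move=> /pinv_ex[a' aa'] /(pnull_mul a'); rewrite pmul0r (pmulC a') aa'.
by move/peps_uniq=> E0; rewrite /popp -E0 pmulC pmulA aa' pmul1.
Qed.

Lemma pnull_sub0 a b : a <> 0 -> pnull a (popp b) 0 -> a = b.
Proof. by move=> a0 /(pnull_two a0)/popp_inj. Qed.

(* Dividing a - b + c = 0 by b shows that a / b is a fundamental element. *)
Lemma fundamental_ratio a b c : a <> 0 -> b <> 0 -> c <> 0 ->
  pnull a (popp b) c -> exists2 z, fundamental z & a = z * b.
Proof.
move=> a0 b0 c0 abc; have [b' bb'] := pinv_ex b0; have b'0 := pinv_neq0 bb'.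
exists (b' * a); last by rewrite (pmulC b') -pmulA (pmulC b') bb' pmul1r.
split; first exact: pmul_neq0.
exists (b' * c); split; first exact: pmul_neq0.
have := pnull_mul b' abc; rewrite -poppM (pmulC b' b) bb'.
by move/pnull_rot/pnull_swap/pnull_rot/pnull_rot.
Qed.

(** If c is nonzero, a / b and k a / (l b) are both fundamental, hence equal. If c = 0, the two
    relations force a = b and k a = l b. *)
Lemma three_term_rigid a b c k l m : at_most_one_fundamental P ->
  a <> 0 -> b <> 0 -> k <> 0 -> l <> 0 -> m <> 0 ->
  pnull a (popp b) c -> pnull (k * a) (popp (l * b)) (m * c) -> k = l.
Proof.
move=> uniqP a0 b0 k0 l0 m0.
have [->|c0] := pselect (c = 0).
  rewrite pmul0r => /(pnull_sub0 a0) <- /(pnull_sub0 (pmul_neq0 k0 a0)).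
  by rewrite !(pmulC _ a); exact: pmulI.
move=> /(fundamental_ratio a0 b0 c0)[z zf az].
move=> /(fundamental_ratio (pmul_neq0 k0 a0) (pmul_neq0 l0 b0) (pmul_neq0 m0 c0)).
case=> z' zf'; rewrite (uniqP _ _ zf' zf) pmulA (pmulC z) -pmulA -az !(pmulC _ a).
exact: pmulI.
Qed.

Definition punit := {a : P | a <> 0}.

HB.instance Definition _ := gen_eqMixin punit.
HB.instance Definition _ := gen_choiceMixin punit.

Definition punit_mul (v w : punit) : punit :=
  exist _ (sval v * sval w) (pmul_neq0 (svalP v) (svalP w)).
Definition punit_one : punit := exist _ 1 (@pone_neq0 P).
Definition punit_inv (v : punit) : punit :=
  let w := cid (pinv_ex (svalP v)) in exist _ (sval w) (pinv_neq0 (svalP w)).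

Lemma punit_neq0 (v : punit) : sval v <> 0.
Proof. exact: (svalP v). Qed.

Lemma punit_inj (v w : punit) : sval v = sval w -> v = w.
Proof. by case: v w => [v v0] [w w0] /= E0; exact: eq_exist. Qed.

Fact punit_mulA : associative punit_mul.
Proof. by move=> v w s; apply: punit_inj; exact: pmulA. Qed.
Fact punit_mulC : commutative punit_mul.
Proof. by move=> v w; apply: punit_inj; exact: pmulC. Qed.
Fact punit_mul1 : left_id punit_one punit_mul.
Proof. by move=> v; apply: punit_inj; exact: pmul1. Qed.
Fact punit_mulV : left_inverse punit_one punit_inv punit_mul.
Proof.
move=> v; apply: punit_inj => /=; rewrite pmulC.
exact: svalP (cid (pinv_ex (svalP v))).
Qed.

(* The multiplicative group of P, written additively. *)
HB.instance Definition _ := GRing.isZmodule.Build punit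
  punit_mulA punit_mulC punit_mul1 punit_mulV.

Lemma pprod_punit r (f : 'I_r -> punit) :
  Defs.pprod (fun i => sval (f i)) = sval (\sum_i f i)%R.
Proof.
have -> : (\sum_i f i = \sum_(i <- enum 'I_r) f i)%R by rewrite big_enum.
rewrite /Defs.pprod; elim: (enum 'I_r) => [|i s IHs] /=; first by rewrite big_nil.
by rewrite big_cons IHs.
Qed.

End PastureArithmetic.

(** * The ratio of two representations and its relations *)

Lemma perm_of_same_image (E : finType) r (x y : {ffun 'I_r -> E}) :
  injective x -> [set x i | i : 'I_r] = [set y i | i : 'I_r] ->
  exists s : 'S_r, x = [ffun i => y (s i)].
Proof.
move=> injx Exy.
have /fin_all_exists[s sE] i : exists j, x i = y j.
  have : x i \in [set y j | j : 'I_r] by rewrite -Exy imset_f.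
  by case/imsetP=> j _ ->; exists j.
have injs : injective s by move=> i j Es; apply: injx; rewrite !sE Es.
by exists (perm injs); apply/ffunP=> i; rewrite ffunE permE.
Qed.

Lemma imset_cat2 (E : finType) r (J : (r - 2).-tuple E) (a b : E) : 1 < r ->
  [set cat2 J a b i | i : 'I_r] = [set e in J] :|: [set a; b].
Proof.
move=> r1; have szJ : size (J ++ [:: a; b]) = r.
  by rewrite size_cat size_tuple /= subnK.
have -> : [set e in J] :|: [set a; b] = [set e in J ++ [:: a; b]].
  by apply/setP=> e; rewrite !inE mem_cat !inE.
apply/setP=> e; rewrite inE; apply/imsetP/idP=> [[i _ ->]|/(nthP a)[i ilt <-]].
  by rewrite ffunE mem_nth // szJ.
by rewrite szJ in ilt; exists (Ordinal ilt); rewrite // ffunE.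
Qed.

Section Representations.
Variables (P : pasture) (E : finType) (bases : {set {set E}}) (r : nat).
Implicit Types D : {ffun 'I_r -> E} -> P.
Local Notation "a * b" := (pmul a b).
Hypothesis rank_r : has_rank bases r.

Lemma basis_injective (x : {ffun 'I_r -> E}) :
  [set x i | i : 'I_r] \in bases -> injective x.
Proof.
move=> /rank_r cardx; have /imset_injP injx : #|[set x i | i : 'I_r]| == #|'I_r|.
  by rewrite cardx card_ord.
by move=> i j; apply: injx.
Qed.

Lemma representation_eq0 D (x : {ffun 'I_r -> E}) : is_representation bases D ->
  [set x i | i : 'I_r] \notin bases -> D x = pzero P.
Proof.
by case=> DB _ /negP xNB; apply: contrapT => /(DB x).
Qed.

(** Reordering a tuple multiplies [D] and [D'] by the same sign, so their quotient depends only on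
    the underlying set. *)
Lemma representation_ratio D D' :
  is_representation bases D -> is_representation bases D' ->
  exists u : {set E} -> punit P,
    forall x, D' x = sval (u [set x i | i : 'I_r]) * D x.
Proof.
move=> repD repD'; have [DB [Ds _]] := repD; have [DB' [Ds' _]] := repD'.
suff /fin_all_exists[u uP] (B : {set E}) : exists v : punit P,
    forall x : {ffun 'I_r -> E}, [set x i | i : 'I_r] = B -> D' x = sval v * D x.
  by exists u => x; exact: uP.
have [BB|BN] := boolP (B \in bases); last first.
  (* Off the bases both sides vanish and any unit will do; [0%R] is the unit 1 in additive
     notation. *)
  exists 0%R => x xB; rewrite -xB in BN.
  by rewrite !(representation_eq0 _ BN) // pmul0r.
have [[y yB]|noy] := pselect
  (exists y : {ffun 'I_r -> E}, [set y i | i : 'I_r] = B);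
  last by exists 0%R => x xB; case: noy; exists x.
have /pinv_ex[b yb] : D y <> pzero P by apply/DB; rewrite yB.
have v0 : D' y * b <> pzero P.
  by apply: pmul_neq0 (pinv_neq0 yb); apply/DB'; rewrite yB.
exists (exist (fun a => a <> pzero P) _ v0) => x xB /=.
have [||s ->] := @perm_of_same_image E r x y; last 1 first.
- rewrite Ds Ds' -!pmulA; rewrite (pmulA b) (pmulC b) -(pmulA _ b) (pmulC b) yb.
  by rewrite pmul1r pmulC.
- by apply: basis_injective; rewrite xB.
by rewrite xB yB.
Qed.


(** Supplies the [J] of the three-term relation: the rank forces [S] to have r - 2 elements. *)
Lemma pair_tuple (S : {set E}) (a b : E) :
  a != b -> a \notin S -> b \notin S -> S :|: [set a; b] \in bases ->
  1 < r /\ exists J : (r - 2).-tuple E, [set e in J] = S.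
Proof.
move=> ab aS bS /rank_r.
rewrite setUC -setUA !cardsU1 !inE negb_or ab aS bS /= => rE.
split; first by rewrite -rE.
have szS : size (enum S) == r - 2 by apply/eqP; rewrite -cardE -rE; lia.
by exists (Tuple szS); apply/setP=> e; rewrite inE mem_enum.
Qed.

Section PairExchange.
Variable (D : {ffun 'I_r -> E} -> P).
Hypothesis repD : is_representation bases D.
Variables (S : {set E}) (a b c d : E).
Hypotheses (ab : a != b) (aS : a \notin S) (bS : b \notin S).
Hypothesis Bab : S :|: [set a; b] \in bases.
Hypothesis Bcd : S :|: [set c; d] \in bases.

(** Otherwise the second and third products vanish and the relation has a single nonzero term,
    contrary to [pnull00]. *)
Lemma representation_pair_exchange :
  (S :|: [set a; c] \in bases) && (S :|: [set b; d] \in bases) ||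
  (S :|: [set a; d] \in bases) && (S :|: [set b; c] \in bases).
Proof.
have [r1 [J JS]] := pair_tuple ab aS bS Bab.
have [DB [_ D3]] := repD.
have imJ e f : [set cat2 J e f i | i : 'I_r] = S :|: [set e; f].
  by rewrite imset_cat2 // JS.
have D0 e f g h :
    ~~ ((S :|: [set e; f] \in bases) && (S :|: [set g; h] \in bases)) ->
    D (cat2 J e f) * D (cat2 J g h) = pzero P.
  rewrite negb_and -!imJ => /orP[] N; rewrite (representation_eq0 repD N) ?pmul0 //.
  exact: pmul0r.
have ab_cd : D (cat2 J a b) * D (cat2 J c d) <> pzero P.
  by apply: pmul_neq0; apply/DB; rewrite imJ.
apply/negPn; rewrite negb_or; apply/negP=> /andP[/D0 E1 /D0 E2].
by have := D3 r1 J a b c d; rewrite E1 E2 popp0 pnull00.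
Qed.

(** The products for [D'] are those for [D] times units built from [u], so [three_term_rigid]
    equates the first two units; the third product may vanish. *)
Lemma representation_pair_weight D' (u : {set E} -> punit P) :
  at_most_one_fundamental P -> is_representation bases D' ->
  (forall x, D' x = sval (u [set x i | i : 'I_r]) * D x) ->
  S :|: [set a; c] \in bases -> S :|: [set b; d] \in bases ->
  (u (S :|: [set a; b]) + u (S :|: [set c; d]) =
  u (S :|: [set a; c]) + u (S :|: [set b; d]))%R.
Proof.
move=> uniqP repD' uE Bac Bbd.
have [r1 [J JS]] := pair_tuple ab aS bS Bab.
have [DB [_ D3]] := repD; have [_ [_ D3']] := repD'.
have imJ e f : [set cat2 J e f i | i : 'I_r] = S :|: [set e; f].
  by rewrite imset_cat2 // JS.
have mulE e f g h : D' (cat2 J e f) * D' (cat2 J g h) =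
    sval (u (S :|: [set e; f]) + u (S :|: [set g; h]))%R *
    (D (cat2 J e f) * D (cat2 J g h)).
  rewrite !uE !imJ -!pmulA; congr (_ * _).
  by rewrite !pmulA (pmulC (D _)).
have D_neq0 e f g h : S :|: [set e; f] \in bases -> S :|: [set g; h] \in bases ->
    D (cat2 J e f) * D (cat2 J g h) <> pzero P.
  by move=> ef gh; apply: pmul_neq0; apply/DB; rewrite imJ.
have := D3' r1 J a b c d; rewrite !mulE => rel'.
apply: punit_inj; apply: (three_term_rigid uniqP _ _ _ _ _ (D3 r1 J a b c d) rel').
- exact: D_neq0 Bab Bcd.
- exact: D_neq0 Bac Bbd.
- exact: punit_neq0.
- exact: punit_neq0.
exact: punit_neq0.
Qed.

End PairExchange.
End Representations.

Theorem mainTheorem12 (P : pasture) (E : finType) (bases : {set {set E}}) (r : nat)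
  (D D' : {ffun 'I_r -> E} -> P) :
  at_most_one_fundamental P ->
  is_matroid bases -> has_rank bases r ->
  is_representation bases D -> is_representation bases D' ->
  rescaling_equiv D D'.
Proof.
move=> uniqP matroid rank_r repD repD'.
have [u uE] := representation_ratio rank_r repD repD'.
have [|S a b c d ab aS bS Bab Bcd Bac Bbd|c [d uB]] :=
  @exchange_weight_affine E (punit P) bases u _ _ matroid.
- by move=> *; apply: (representation_pair_exchange rank_r repD).
- exact: (representation_pair_weight rank_r repD ab aS bS Bab Bcd uniqP repD' uE).
exists (sval c), (fun e => sval (d e)); split; first exact: punit_neq0.
split=> [e|x]; first exact: punit_neq0.
have [xB|xN] := boolP ([set x i | i : 'I_r] \in bases); last first.
  by rewrite !(representation_eq0 _ xN) // !pmul0r.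
(* The entries of [x] are distinct, so the sum over the basis is the sum over positions. *)
rewrite pprod_punit pmulA uE uB // big_imset //=.
by move=> i j _ _; exact: (basis_injective rank_r xB).
Qed.
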